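(* For every $n\in\mathbb{N}$, both $12^{-n}\det[D_{i+j}]_{0\le i,j\le n}$ and $2^{-n(n+3)}\det[P_{i+j}]_{0\le i,j\le n}$ are positive odd integers.
   Context: For $m\in\mathbb{N}$, the Domb numbers are $D_m=\sum_{k=0}^m\binom{m}{k}^2\binom{2k}{k}\binom{2(m-k)}{m-k}$, and the Catalan–Larcombe–French numbers are $P_m=\sum_{k=0}^m\frac{\binom{2k}{k}^2\binom{2(m-k)}{m-k}^2}{\binom{m}{k}}$. For a sequence $(a_m)_{m\ge0}$, $\det[a_{i+j}]_{0\le i,j\le n}$ denotes the determinant of the $(n+1)\times(n+1)$ Hankel matrix with $(i,j)$-entry $a_{i+j}$. *)

(* Defs.v *)
From HB Require Import structures.
From mathcomp Require Import all_boot all_order all_algebra.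
Set Implicit Arguments. Unset Strict Implicit. Unset Printing Implicit Defensive.
Import Order.TTheory GRing.Theory Num.Theory.

Definition Domb (m : nat) : nat :=
  \sum_(k < m.+1) 'C(m, k) ^ 2 * 'C(2 * k, k) * 'C(2 * (m - k), m - k).

(* Catalan--Larcombe--French numbers P_m, computed in rat since the
   individual summands need not be integers. *)
Definition CLF (m : nat) : rat :=
  \sum_(k < m.+1)
    (('C(2 * k, k) ^ 2 * 'C(2 * (m - k), m - k) ^ 2)%:R / ('C(m, k))%:R)%R.

Definition hankel_det (R : comNzRingType) (a : nat -> R) (n : nat) : R :=
  \det (\matrix_(i < n.+1, j < n.+1) a (i + j)%N).

(* Main.v *)
Require Import Defs.
From mathcomp Require Import all_boot all_order all_algebra.
From mathcomp Require Import all_field zify ring.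
Import Order.TTheory GRing.Theory Num.Theory.
Set Implicit Arguments. Unset Strict Implicit. Unset Printing Implicit Defensive.
Local Open Scope ring_scope.

(* Write E for the mean over the unit circle, replaced throughout by the mean
   over the M-th roots of unity with M large, so that everything is a finite sum.
   Then D_m = E |1 + x + (1 + y) w|^(2m), and with u = x + 1/x, v = y + 1/y
   also P_m = E (8 + 2uv)^m; the latter because P_m = sum_k C(m,k) S(k,m-k)^2 for
   the super Catalan numbers S(k,l) = E (2+u)^k (2-u)^l.  The second formula
   reduces the Hankel determinant of P to that of R_m = E (uv)^m, which is
   C(m,m/2)^2 for m even and 0 for m odd.

   D and R are moment sequences of real variables, so their Hankel matrices are
   positive semidefinite and the determinants are positive once nonzero.

   Both sequences start with 1 and are divisible by 4 afterwards, and modulo 2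
   the quotient a_{m+2}/4 is the m-th aerated Catalan number, whose Hankel
   determinants are 1; hence the determinants are 4^n times an odd number.
   Finally D_m = 1 modulo 3, so 3^n divides the Hankel determinant of D. *)

(** * Generalities on Hankel determinants *)

Lemma hankel_det_map (R S : comNzRingType) (f : {rmorphism R -> S})
    (a : nat -> R) n :
  hankel_det (fun m => f (a m)) n = f (hankel_det a n).
Proof.
by rewrite /hankel_det -det_map_mx; congr (\det _); apply/matrixP=> i j; rewrite !mxE.
Qed.

Lemma eq_hankel_det (R : comNzRingType) (a b : nat -> R) n :
  a =1 b -> hankel_det a n = hankel_det b n.
Proof. by move=> e; congr (\det _); apply/matrixP=> i j; rewrite !mxE e. Qed.

(* A row of the adjugate is a vector on which the quadratic form takes the
   value below, so nonsingular minors of a semidefinite form are positive. *)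
Lemma hankel_detM_quadratic (R : comNzRingType) (a : nat -> R) n :
  exists x : 'I_n.+2 -> R,
    hankel_det a n * hankel_det a n.+1 = \sum_i \sum_j x i * x j * a (i + j)%N.
Proof.
pose A : 'M[R]_n.+2 := \matrix_(i, j) a (i + j)%N.
exists (fun i => \adj A ord_max i).
have minorE : \adj A ord_max ord_max = hankel_det a n.
  rewrite mxE /cofactor /hankel_det -signr_odd addnn odd_double mul1r.
  by congr (\det _); apply/matrixP=> i j; rewrite !mxE !lift_max.
have e : \sum_j (\adj A *m A) ord_max j * \adj A ord_max j
    = hankel_det a n * hankel_det a n.+1.
  rewrite mul_adj_mx (bigD1 ord_max) //= big1 => [|j jN]; last first.
    by rewrite mxE eq_sym (negPf jN) mulr0n mul0r.
  by rewrite mxE eqxx mulr1n addr0 minorE mulrC.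
rewrite -e exchange_big; apply: eq_bigr => j _; rewrite mxE mulr_suml.
by apply: eq_bigr => i _; rewrite [A i j]mxE; ring.
Qed.

Lemma hankel_det_gt0 (R : realDomainType) (a : nat -> R) :
    0 < a 0%N ->
    (forall n, hankel_det a n != 0) ->
    (forall n (x : 'I_n -> R), 0 <= \sum_i \sum_j x i * x j * a (i + j)%N) ->
  forall n, 0 < hankel_det a n.
Proof.
move=> a0 nz psd; elim=> [|n IHn].
  by rewrite /hankel_det (expand_det_row _ ord0) big_ord1 mxE /cofactor det_mx00 !mulr1.
have [x e] := hankel_detM_quadratic a n.
have: 0 <= hankel_det a n * hankel_det a n.+1 by rewrite e psd.
by rewrite pmulr_rge0 // le_eqVlt eq_sym (negPf (nz _)).
Qed.

(** Subtracting [l] times row 0 from each of the other [n] rows leaves multiples of [q]; the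
    unitriangular [L] undoes the subtraction. It serves with [l = 0], [q = 4] and with [l = 1],
    [q = 3]. *)
Lemma hankel_det_factor (R : comNzRingType) (a : nat -> R) (l q : R)
    (N : nat -> nat -> R) n :
    (forall i j, a (i.+1 + j)%N = l * a j + q * N i.+1 j) ->
  hankel_det a n =
    q ^+ n * \det (\matrix_(i < n.+1, j < n.+1) if i == ord0 then a j else N i j).
Proof.
move=> aE.
pose D : 'rV[R]_n.+1 := \row_i if i == ord0 then 1 else q.
pose L : 'M[R]_n.+1 := \matrix_(i, j) ((i == j)%:R + (if (j == ord0) && (i != ord0) then l else 0)).
pose M : 'M[R]_n.+1 := \matrix_(i, j) if i == ord0 then a j else N i j.
have detL : \det L = 1.
  rewrite det_trig.
    by rewrite big1 // => i _; rewrite mxE eqxx; case: (i == ord0); rewrite /= addr0.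
  apply/is_trig_mxP=> i j lij; rewrite mxE.
  have /negPf -> : i != j by rewrite -val_eqE ltn_eqF.
  have /negPf -> : j != ord0 by rewrite -val_eqE /=; lia.
  by rewrite addr0.
have detD : \det (diag_mx D) = q ^+ n.
  rewrite det_diag big_ord_recl mxE eqxx mul1r.
  under eq_bigr => i _ do rewrite mxE.
  by rewrite prodr_const card_ord.
rewrite -detD -det_mulmx /hankel_det.
have -> : \matrix_(i < n.+1, j < n.+1) a (i + j)%N = L *m (diag_mx D *m M).
  apply/matrixP=> i j; rewrite mul_diag_mx !mxE.
  under eq_bigr => k _ do rewrite !mxE mulrDl.
  rewrite big_split /=.
  rewrite (bigD1 i) //= eqxx big1 ?addr0 => [|k kN]; last first.
    by rewrite eq_sym (negPf kN) mul0r.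
  rewrite (bigD1 ord0) //= big1 ?addr0 => [|k kN]; last by rewrite (negPf kN) mul0r.
  rewrite mul1r; case: (unliftP ord0 i) => [k ->|->]; last first.
    by rewrite !eqxx /= mul0r addr0 !mul1r add0n.
  have -> : (lift ord0 k == ord0) = false by [].
  by rewrite /= /bump leq0n add1n aE mul1r addrC.
by rewrite [LHS]det_mulmx detL mul1r.
Qed.

(** * Aerated Catalan numbers: Hankel determinants and parity *)

(* Dyck prefixes of length [n] ending at height [k]. *)
Fixpoint ballot (n k : nat) : nat :=
  if n is n'.+1 then ((if k is k'.+1 then ballot n' k' else 0) + ballot n' k.+1)%N
  else (k == 0)%N.

Lemma ballot_small n k : (n < k)%N -> ballot n k = 0%N.
Proof.
elim: n k => [|n IHn] [|k] //= ltnk.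
by rewrite !IHn //; lia.
Qed.

Lemma ballotnn n : ballot n n = 1%N.
Proof. by elim: n => //= n ->; rewrite ballot_small. Qed.

Lemma sum_ballotS i j N : (i <= N)%N ->
  (\sum_(k < N.+1) ballot i.+1 k * ballot j k =
   \sum_(k < N) ballot i k * ballot j k.+1 + \sum_(k < N) ballot i k.+1 * ballot j k)%N.
Proof.
move=> leiN; transitivity
  (\sum_(k < N.+1) ((if nat_of_ord k is k'.+1 then ballot i k' else 0) * ballot j k)
   + \sum_(k < N.+1) ballot i k.+1 * ballot j k)%N.
  by rewrite -big_split /=; apply: eq_bigr => k _; rewrite mulnDl.
congr addn; first by rewrite big_ord_recl /= mul0n add0n.
by rewrite big_ord_recr /= (@ballot_small i) ?mul0n ?addn0.
Qed.

(** The step relation between heights is symmetric, so a step can pass from one path to the other.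
    Paths of length at most [N] never climb above [N], so the truncation loses nothing. *)
Lemma sum_ballot_shift i j N : (i <= N)%N -> (j <= N)%N ->
  (\sum_(k < N.+1) ballot i.+1 k * ballot j k =
   \sum_(k < N.+1) ballot i k * ballot j.+1 k)%N.
Proof.
move=> leiN lejN; rewrite sum_ballotS //.
under [RHS]eq_bigr => k _ do rewrite mulnC.
rewrite sum_ballotS // addnC.
by congr addn; apply: eq_bigr => k _; rewrite mulnC.
Qed.

(** A Dyck path cut after [i] steps, with its second piece reversed, is a pair of prefixes ending at
    a common height, which is at most [i]. *)
Lemma sum_ballot i j N : (i < N)%N ->
  (\sum_(k < N) ballot i k * ballot j k = ballot (i + j) 0)%N.
Proof.
have big i' j' N' : (i' + j' <= N')%N ->
    (\sum_(k < N'.+1) ballot i' k * ballot j' k = ballot (i' + j') 0)%N.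
  elim: i' j' => [|i' IHi] j' le_ij.
    by rewrite big_ord_recl /= mul1n big1 // addn0.
  by rewrite sum_ballot_shift ?IHi ?addnS ?addSn //; lia.
move=> ltiN; rewrite -(big i j (i + j + N)%N) ?leq_addr //.
rewrite (big_ord_widen (i + j + N).+1 (fun k => ballot i k * ballot j k)%N); last by lia.
rewrite big_mkcond; apply: eq_bigr => k _.
by case: ltnP => // leNk; rewrite ballot_small //; lia.
Qed.

(** [sum_ballot] factors the matrix as [C *m C^T] with [C] lower unitriangular. *)
Lemma det_ballot (R : comNzRingType) n :
  \det (\matrix_(i < n, j < n) (ballot (i + j) 0)%:R) = 1 :> R.
Proof.
pose C : 'M[R]_n := \matrix_(i, j) (ballot i j)%:R.
have detC : \det C = 1.
  rewrite det_trig; first by rewrite big1 // => i _; rewrite mxE ballotnn.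
  by apply/is_trig_mxP=> i j ltij; rewrite mxE ballot_small.
have -> : \matrix_(i < n, j < n) (ballot (i + j) 0)%:R = C *m C^T.
  apply/matrixP=> i j; rewrite !mxE -(sum_ballot _ (ltn_ord i)) natr_sum.
  by apply: eq_bigr => k _; rewrite !mxE natrM.
by rewrite det_mulmx det_tr detC mulr1.
Qed.

Lemma ballot_odd0 n k : odd (n + k) -> ballot n k = 0%N.
Proof.
elim: n k => [|n IHn] k; first by case: k.
rewrite addSn /= => nk; rewrite IHn ?addnS //.
by case: k nk => // k; rewrite addnS /= negbK => /IHn ->.
Qed.

Lemma odd_bin_double j : (0 < j)%N -> odd 'C(j.*2, j) = false.
Proof.
case: j => // j _; rewrite doubleS binS -addnn -addSn.
rewrite -[X in (X + _)%N]bin_sub; last by lia.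
by rewrite (_ : j.+1 + j - j.+1 = j)%N ?addnn ?odd_double //; lia.
Qed.

(** With [j] down steps, reflection counts [C(n,j) - C(n,j-1)] paths of length [n = 2j + k]; modulo
    2 this is the Pascal sum [C(n+1,j)]. The induction on the length uses only Pascal's rule. *)
Lemma odd_ballot j k : odd (ballot (j.*2 + k) k) = odd 'C((j.*2 + k).+1, j).
Proof.
move: {2}(j.*2 + k)%N (leqnn (j.*2 + k)) => n; elim: n j k => [|n IHn] j k.
  by rewrite leqn0 addn_eq0 double_eq0 => /andP[/eqP -> /eqP ->].
case: k => [|k].
  case: j => [//|j]; rewrite !addn0 doubleS => le_jn.
  have := IHn j 1%N; rewrite addn1 => /(_ ltac:(lia)) /= IH.
  by rewrite add0n IH (binS j.*2.+2) oddD -doubleS odd_bin_double.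
rewrite addnS => le_jn /=; rewrite oddD IHn //.
case: j le_jn => [|j] le_jn; first by rewrite double0 add0n ballot_small // !bin0.
rewrite (_ : j.+1.*2 + k = j.*2 + k.+2)%N; last by lia.
by rewrite IHn ?binS ?oddD //; lia.
Qed.

Lemma odd_ballot0 m : odd (ballot m 0) = ~~ odd m && odd 'C(m.+1, m./2).
Proof.
case: (boolP (odd m)) => /= om; first by rewrite ballot_odd0 ?addn0.
by rewrite -{1 2}(even_halfK om) -[in LHS](addn0 (m./2).*2) odd_ballot addn0.
Qed.

(** * Odd part of a Hankel determinant *)

Lemma intr_F2_odd (c : int) : c%:~R = 1 :> 'F_2 -> odd `|c|%N.
Proof.
move=> c1; apply: contraT; rewrite -dvdn2 (dvdn_pcharf (pchar_Fp (isT : prime 2))).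
move: c1; case: c => c.
  by rewrite -pmulrn => ->; rewrite oner_eq0.
rewrite NegzE mulrNz -pmulrn abszN /= => e.
by rewrite -oppr_eq0 e oner_eq0.
Qed.

Lemma hankel_det_odd4 (a : nat -> nat) n :
    a 0 = 1%N -> (forall m, 4 %| a m.+1)%N ->
    (forall m, odd (a m.+2 %/ 4) = odd (ballot m 0)) ->
  exists2 c : int, odd `|c|%N & hankel_det (fun m => (a m)%:Z) n = 4 ^+ n * c.
Proof.
move=> a0 a4 a2; pose N i j : int := Posz (a (i + j)%N %/ 4).
have aE i j : (a (i.+1 + j)%N)%:Z = 0 * (a j)%:Z + 4 * N i.+1 j.
  by rewrite mul0r add0r -[4]/(Posz 4) -PoszM mulnC divnK ?a4.
eexists; last exact: (@hankel_det_factor _ (fun m => (a m)%:Z) 0 4 N n aE).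
apply: intr_F2_odd; rewrite -(det_map_mx (intr : int -> 'F_2)).
(* Modulo 2 the first row is [(1, 0, ..., 0)], so only the minor with entries [a (i + j).+2 %/ 4]
   remains. *)
rewrite (expand_det_row _ ord0) big_ord_recl big1 => [|j _]; last first.
  rewrite !mxE eqxx /= (_ : _%:~R = 0) ?mul0r //.
  apply/eqP; rewrite -pmulrn -(dvdn_pcharf (pchar_Fp (isT : prime 2))).
  exact: (@dvdn_trans 4).
rewrite !mxE a0 mul1r addr0 /cofactor mul1r -[RHS](det_ballot _ n).
congr (\det _); apply/matrixP=> i j; rewrite !mxE /= /N /bump !leq0n !add1n addSn addnS.
by rewrite -pmulrn -[LHS]Zp_nat_mod // -[RHS]Zp_nat_mod // !modn2 a2.
Qed.

(** * Binomial coefficients modulo a prime *)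

Lemma bin_addp_small p m s : prime p -> (s < p)%N ->
  ('C(m + p, s))%:R = ('C(m, s))%:R :> 'F_p.
Proof.
move=> p_pr ltsp; rewrite addnC -binomial.Vandermonde big_ord_recl bin0 mul1n subn0.
rewrite natrD natr_sum big1 ?addr0 // => j _; apply/eqP.
rewrite -(dvdn_pcharf (pchar_Fp p_pr)) dvdn_mulr // prime_dvd_bin //=.
by rewrite /bump; have := ltn_ord j; lia.
Qed.

(** This compares coefficients in [(1+X)^(m+p) = (1+X)^m (1+X^p)]: in Vandermonde's sum only the
    indices 0 and [p] survive. *)
Lemma bin_addp p m j : prime p ->
  ('C(m + p, j + p))%:R = ('C(m, j) + 'C(m, j + p))%:R :> 'F_p.
Proof.
move=> p_pr; have p0 := prime_gt0 p_pr.
rewrite [in LHS]addnC -binomial.Vandermonde natr_sum.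
have ltp : (p < (j + p).+1)%N by lia.
rewrite (bigD1 ord0) // (bigD1 (Ordinal ltp)) /=; last by rewrite -val_eqE /= -lt0n.
rewrite big1 => [|i /andP[]]; last first.
  rewrite -!val_eqE /= => i0 ip; case: (ltnP i p) => ltip; last first.
    by rewrite bin_small ?mul0n // ltn_neqAle eq_sym ip.
  apply/eqP; rewrite -(dvdn_pcharf (pchar_Fp p_pr)) dvdn_mulr // prime_dvd_bin //.
  by rewrite lt0n i0.
by rewrite bin0 binn !mul1n subn0 addnK addr0 natrD addrC.
Qed.

(** Lucas' theorem for the lowest digit: multiplying by [1+X^p] raises [n] by one and acts on [k] as
    Pascal's rule. *)
Lemma bin_Lucas p n k r s : prime p -> (r < p)%N -> (s < p)%N ->
  ('C(p * n + r, p * k + s))%:R = ('C(n, k) * 'C(r, s))%:R :> 'F_p.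
Proof.
move=> p_pr ltrp ltsp; elim: n k => [|n IHn] k.
  rewrite muln0 add0n; case: k => [|k]; first by rewrite muln0 add0n mul1n.
  by rewrite bin_small ?mul0n // mulnS; lia.
have -> : (p * n.+1 + r = p * n + r + p)%N by rewrite mulnS; lia.
case: k => [|k].
  by rewrite muln0 add0n bin_addp_small // -[s]add0n -(muln0 p) IHn !bin0 muln0.
have -> : (p * k.+1 + s = p * k + s + p)%N by rewrite mulnS; lia.
rewrite bin_addp // natrD IHn.
have -> : (p * k + s + p = p * k.+1 + s)%N by rewrite mulnS; lia.
by rewrite IHn -natrD -mulnDl addnC -binS.
Qed.

Lemma odd_bin_Lucas n k r s : (r < 2)%N -> (s < 2)%N ->
  odd 'C(2 * n + r, 2 * k + s) = odd ('C(n, k) * 'C(r, s)).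
Proof.
move=> lr ls; apply: negb_inj; rewrite -!dvdn2 !(dvdn_pcharf (pchar_Fp (isT : prime 2))).
by rewrite bin_Lucas.
Qed.

(** Brings the parity of [Domb4 m.+1] to the form required by [hankel_det_odd4]. *)
Lemma odd_bin_ballot m : odd 'C(2 * m.+1 + 1, m.+1) = odd (ballot m 0).
Proof.
rewrite odd_ballot0; case: (boolP (odd m)) => /= om.
  have eqm : (m.+1 = 2 * (m./2).+1 + 0)%N by lia.
  rewrite [X in 'C(_, X)]eqm odd_bin_Lucas // bin0 muln1.
  by rewrite (_ : m.+1 = (m./2).+1.*2) ?odd_bin_double //; lia.
have eqm : (m.+1 = 2 * (m./2) + 1)%N by lia.
by rewrite [X in 'C(_, X)]eqm odd_bin_Lucas // bin1 muln1.
Qed.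

(** * Domb numbers modulo 8 *)

Lemma odd_sum_palindrome n (g : nat -> nat) :
    (forall k, (k < n)%N -> g (n.-1 - k)%N = g k) -> (odd n -> ~~ odd (g n./2)) ->
  ~~ odd (\sum_(k < n) g k).
Proof.
have [h] := ubnP n; elim: h n g => // h IHh [|[|n]] g lt_nh gpal gmid.
- by rewrite big_ord0.
- by rewrite big_ord1; apply: gmid.
(* The two end terms are equal and cancel modulo 2; the inner terms again form a palindrome with the
   same middle. *)
have g1 : g n.+1 = g 0%N by have := gpal 0%N isT; rewrite subn0.
rewrite big_ord_recl big_ord_recr /= g1 addnCA addnn oddD odd_double addbF.
under eq_bigr => k _ do rewrite [bump 0 k]add1n.
apply: (IHh n (fun k => g k.+1)); first by lia.
  move=> k ltkn; have <- := gpal k.+1 (leqW ltkn).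
  by rewrite (_ : n.+2.-1 - k.+1 = (n.-1 - k).+1)%N //=; lia.
by move=> on; apply: gmid; rewrite /= negbK.
Qed.

Lemma bin_central_half k : ('C(2 * k.+1, k.+1) = 2 * 'C(2 * k + 1, k))%N.
Proof.
rewrite (_ : 2 * k.+1 = (2 * k + 1).+1)%N; last by lia.
rewrite binS -[X in (X + _)%N]bin_sub; last by lia.
by rewrite (_ : 2 * k + 1 - k.+1 = k)%N; lia.
Qed.

(** The quotient of [Domb n.+1] by 4: both end terms of that sum equal [2 * 'C(2 * n + 1, n)], and
    every inner term has two even central binomial factors. The inner index is shifted by one. *)
Definition Domb4 n :=
  ('C(2 * n + 1, n)
   + \sum_(k < n) 'C(n.+1, k.+1) ^ 2 * 'C(2 * k + 1, k) * 'C(2 * (n.-1 - k) + 1, n.-1 - k))%N.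

Lemma Domb4E n : Domb n.+1 = (4 * Domb4 n)%N.
Proof.
rewrite /Domb big_ord_recl big_ord_recr /=.
rewrite !bin0 !binn ?bump0 subn0 subnn !bin0 !exp1n !muln1 !mul1n.
have -> : (\sum_(i < n) 'C(n.+1, bump 0 i) ^ 2 * 'C(2 * bump 0 i, bump 0 i)
    * 'C(2 * (n.+1 - bump 0 i), n.+1 - bump 0 i)
  = 4 * \sum_(k < n) 'C(n.+1, k.+1) ^ 2 * 'C(2 * k + 1, k) * 'C(2 * (n.-1 - k) + 1, n.-1 - k))%N.
  rewrite big_distrr /=; apply: eq_bigr => k _; rewrite [bump 0 k]add1n bin_central_half.
  have -> : (n.+1 - k.+1 = (n.-1 - k).+1)%N by have := ltn_ord k; lia.
  by rewrite bin_central_half; lia.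
by rewrite /Domb4 mulnDr bin_central_half; lia.
Qed.

(** The inner sum is a palindrome whose middle term, present for odd [n], contains an even central
    binomial coefficient. *)
Lemma odd_Domb4 n : odd (Domb4 n) = odd 'C(2 * n + 1, n).
Proof.
rewrite /Domb4 oddD -[RHS]addbF; congr (_ (+) _); apply: negbTE.
apply: (@odd_sum_palindrome n (fun k =>
  'C(n.+1, k.+1) ^ 2 * 'C(2 * k + 1, k) * 'C(2 * (n.-1 - k) + 1, n.-1 - k))%N).
  move=> k ltkn; rewrite subKn; last by lia.
  rewrite -['C(n.+1, (_ - _).+1)]bin_sub; last by lia.
  rewrite (_ : n.+1 - (n.-1 - k).+1 = k.+1)%N; last by lia.
  by rewrite mulnAC.
move=> on; rewrite !oddM /= (_ : n.+1 = (n./2).+1.*2); last by lia.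
by rewrite odd_bin_double.
Qed.

(** * Domb numbers modulo 3 *)

Lemma sum_ord3 (V : nmodType) (F : nat -> V) n :
  \sum_(k < 3 * n) F k
    = \sum_(k < n) (F (3 * k)%N + F (3 * k + 1)%N + F (3 * k + 2)%N).
Proof.
elim: n => [|n IHn]; first by rewrite !big_ord0.
rewrite (_ : 3 * n.+1 = (3 * n).+3)%N; last by lia.
by rewrite !big_ord_recr /= IHn !addrA addn1 addn2.
Qed.

Definition Domb_term n k := ('C(n, k) ^ 2 * 'C(2 * k, k) * 'C(2 * (n - k), n - k))%N.

Lemma bin_central_mod3 k r : (r < 3)%N ->
  ('C(2 * (3 * k + r), 3 * k + r))%:R = ('C(2 * k, k) * 'C(2 * r, r))%:R :> 'F_3.
Proof.
case: r => [|[|[|r]]] // _.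
- by rewrite addn0 mulnCA -[(3 * (2 * k))%N]addn0 -[(3 * k)%N]addn0 bin_Lucas.
- by rewrite (_ : 2 * (3 * k + 1) = 3 * (2 * k) + 2)%N ?bin_Lucas //; lia.
(* Doubling the digit 2 carries and leaves the digit 1, so Lucas gives 0; the right side vanishes
   since ['C(4, 2) = 6]. *)
rewrite (_ : 2 * (3 * k + 2) = 3 * (2 * k + 1) + 1)%N; last by lia.
rewrite bin_Lucas // muln0 natrM (_ : ('C(2 * 2, 2))%:R = 0 :> 'F_3) ?mulr0 //.
by apply/val_inj.
Qed.

Lemma Domb_term_mod3 n k r s : (r < 3)%N -> (s < 3)%N -> (k <= n)%N ->
  (Domb_term (3 * n + r) (3 * k + s))%:R = (Domb_term n k * Domb_term r s)%:R :> 'F_3.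
Proof.
move=> lr ls lekn; rewrite /Domb_term; case: (leqP s r) => lesr; last first.
  by rewrite !natrM bin_Lucas // (bin_small lesr) muln0 !(mul0r, mulr0).
have -> : (3 * n + r - (3 * k + s) = 3 * (n - k) + (r - s))%N by lia.
rewrite !natrM bin_Lucas // !bin_central_mod3 ?natrM; [|lia..].
ring.
Qed.

Lemma sum_Domb_term n N : (n < N)%N -> (\sum_(k < N) Domb_term n k = Domb n)%N.
Proof.
move=> ltnN; rewrite /Domb (big_ord_widen _ (Domb_term n) ltnN) [RHS]big_mkcond.
apply: eq_bigr => k _; case: ifP => // /negbT; rewrite -leqNgt => ltnk.
by rewrite /Domb_term bin_small.
Qed.

(** Summing [Domb_term_mod3] gives [D_(3q+r) = D_q D_r] modulo 3, and [D_0, D_1, D_2] are 1, 4,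
    28. *)
Lemma Domb_mod3 n : (Domb n)%:R = 1 :> 'F_3.
Proof.
have [h] := ubnP n; elim: h n => // h IHh n lt_nh.
have [->|n0] := posnP n; first by rewrite /Domb big_ord1.
have lt3 : (n %% 3 < 3)%N by rewrite ltn_mod.
have nE : n = (3 * (n %/ 3) + n %% 3)%N by lia.
move: (n %/ 3)%N (n %% 3)%N lt3 nE => q r lt3 nE.
have IHq : (Domb q)%:R = 1 :> 'F_3 by apply: IHh; lia.
(* Terms beyond [n] vanish, so the range is padded to complete blocks of three. *)
rewrite -(@sum_Domb_term n (3 * q.+1)) ?natr_sum; last by lia.
rewrite (sum_ord3 (fun k => (Domb_term n k)%:R)) nE.
transitivity (\sum_(k < q.+1)
  (Domb_term q k * (Domb_term r 0 + Domb_term r 1 + Domb_term r 2))%:R : 'F_3).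
  apply: eq_bigr => k _; have lekq : (k <= q)%N by rewrite -ltnS.
  have E s := @Domb_term_mod3 q k r s lt3 ^~ lekq.
  by rewrite -[X in Domb_term _ X]addn0 (E 0%N isT) (E 1%N isT) (E 2 isT) -!natrD -!mulnDr.
rewrite -natr_sum -big_distrl /= sum_Domb_term // natrM IHq mul1r.
by case: r lt3 {nE} => [|[|[|r]]] // _; apply/val_inj; vm_compute.
Qed.

(** * Averages over roots of unity *)

Section CircleMean.

Variables (M : nat) (z : algC).
Hypothesis zP : M.-primitive_root z.

(** On Laurent polynomials with exponents below [M] in absolute value this extracts the constant
    term, whence the bounds [m < M] below. *)
Definition mean (f : algC -> algC) : algC := M%:R^-1 * \sum_(t < M) f (z ^+ t).

Lemma eq_mean f g : (forall x, f x = g x) -> mean f = mean g.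
Proof. by move=> e; rewrite /mean; under eq_bigr => t _ do rewrite e. Qed.

Lemma meanZ c f : mean (fun x => c * f x) = c * mean f.
Proof. by rewrite /mean -mulr_sumr mulrCA. Qed.

Lemma mean_sum n (F : 'I_n -> algC -> algC) :
  mean (fun x => \sum_i F i x) = \sum_i mean (F i).
Proof. by rewrite /mean exchange_big mulr_sumr. Qed.

Lemma meanB f g : mean (fun x => f x - g x) = mean f - mean g.
Proof. by rewrite /mean sumrB mulrBr. Qed.

Lemma mean_ge0 f : (forall x, x^-1 = x^* -> 0 <= f x) -> 0 <= mean f.
Proof.
move=> f0; rewrite mulr_ge0 ?invr_ge0 ?ler0n // sumr_ge0 // => t _; apply: f0.
have zt1 : (z ^+ t) ^+ M = 1 by rewrite exprAC (prim_expr_order zP) expr1n.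
have : `|z ^+ t| ^+ M == 1 by rewrite -normrX zt1 normr1.
rewrite pexpr_eq1 ?(prim_order_gt0 zP) // => /eqP n1.
by rewrite invC_norm n1 expr1n invr1 mul1r.
Qed.

Lemma prim_root_neq0 : z != 0.
Proof.
apply/eqP=> z0; have /eqP := prim_expr_order zP.
by rewrite z0 expr0n gtn_eqF ?(prim_order_gt0 zP) // eq_sym oner_eq0.
Qed.

(** Orthogonality: for distinct [a] and [b] the ratio [w] is an [M]-th root of unity other than 1,
    so its geometric sum vanishes. *)
Lemma mean_monomial a b : (a < M)%N -> (b < M)%N ->
  mean (fun x => x ^+ a * x^-1 ^+ b) = (a == b)%:R.
Proof.
move=> ltaM ltbM; have M0 : M%:R != 0 :> algC by rewrite pnatr_eq0; lia.
pose w := z ^+ a / z ^+ b.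
have -> : mean (fun x => x ^+ a * x^-1 ^+ b) = M%:R^-1 * \sum_(t < M) w ^+ t.
  by congr (_ * _); apply: eq_bigr => t _; rewrite /w exprMn !exprVn exprAC [in X in _ / X]exprAC.
have [eab|nab] := eqVneq a b.
  rewrite /w eab divff ?expf_neq0 ?prim_root_neq0 //.
  under eq_bigr => t _ do rewrite expr1n.
  by rewrite sumr_const card_ord mulVf.
have w1 : w != 1.
  apply: contra nab => /eqP /(divr1_eq) /eqP.
  by rewrite (eq_prim_root_expr zP) !modn_small.
have : (w - 1) * \sum_(t < M) w ^+ t = 0.
  rewrite -subrX1 /w exprMn exprVn !(exprAC _ _ M) (prim_expr_order zP) !expr1n.
  by rewrite invr1 mulr1 subrr.
by move/eqP; rewrite mulf_eq0 subr_eq0 (negPf w1) => /eqP ->; rewrite mulr0.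
Qed.

Lemma mean_normsq_expr p p' q q' m : (m < M)%N ->
  mean (fun x => (p + q * x) ^+ m * (p' + q' * x^-1) ^+ m)
    = \sum_(k < m.+1) ('C(m, k) ^ 2)%N%:R * (p * p') ^+ (m - k) * (q * q') ^+ k.
Proof.
move=> ltmM.
have e x : (p + q * x) ^+ m * (p' + q' * x^-1) ^+ m =
    \sum_(i < m.+1) \sum_(j < m.+1) ('C(m, i) * 'C(m, j))%N%:R * (p ^+ (m - i) * q ^+ i) *
       (p' ^+ (m - j) * q' ^+ j) * (x ^+ i * x^-1 ^+ j).
  rewrite !exprDn big_distrlr /=; apply: eq_bigr => i _; apply: eq_bigr => j _.
  by rewrite !exprMn -[_ *+ 'C(m, i)]mulr_natr -[_ *+ 'C(m, j)]mulr_natr natrM; ring.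
rewrite (eq_mean e) mean_sum; apply: eq_bigr => i _; rewrite mean_sum.
rewrite (bigD1 i) //= big1 ?addr0 => [|j jN].
  rewrite meanZ mean_monomial ?(leq_trans (ltn_ord i)) // eqxx mulr1 !exprMn -mulnn natrM.
  by ring.
rewrite meanZ mean_monomial ?(leq_trans (ltn_ord _)) //.
by rewrite eq_sym val_eqE (negPf jN) mulr0.
Qed.

Lemma mean_central m : (m < M)%N ->
  mean (fun x => (1 + x) ^+ m * (1 + x^-1) ^+ m) = ('C(2 * m, m))%:R.
Proof.
move=> ltmM; rewrite mul2n -addnn -binomial.Vandermonde natr_sum.
rewrite -[LHS](eq_mean (fun x => congr2 (fun a b => (1 + a) ^+ m * (1 + b) ^+ m)
   (mul1r x) (mul1r x^-1))) mean_normsq_expr //.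
apply: eq_bigr => k _; rewrite !mul1r !expr1n !mulr1.
by rewrite (@bin_sub m k) // -ltnS.
Qed.

(** The constant term of [(x + 1/x)^m]. *)
Definition central m : nat := if odd m then 0 else 'C(m, m./2).

Lemma mean_cos_expr m : (m < M)%N ->
  mean (fun x => (x + x^-1) ^+ m) = (central m)%:R.
Proof.
move=> ltmM.
have e (x : algC) : (x + x^-1) ^+ m = \sum_(i < m.+1) ('C(m, i))%:R * (x ^+ (m - i) * x^-1 ^+ i).
  by rewrite exprDn; apply: eq_bigr => i _; rewrite -mulr_natr mulrC.
rewrite (eq_mean e) mean_sum.
have t (i : 'I_m.+1) : mean (fun x => ('C(m, i))%:R * (x ^+ (m - i) * x^-1 ^+ i)) =
     ('C(m, i) * (m - i == i))%N%:R.
  by rewrite natrM meanZ mean_monomial //; have := ltn_ord i; lia.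
under eq_bigr => i _ do rewrite t.
rewrite -natr_sum /central; congr _%:R; case: (boolP (odd m)) => om.
  by rewrite big1 // => i _; case: eqP => [|_]; [lia | rewrite muln0].
have lth : (m./2 < m.+1)%N by lia.
rewrite (bigD1 (Ordinal lth)) //= big1 => [|i]; last first.
  by rewrite -val_eqE /= => ni; case: eqP => [|_]; [lia | rewrite muln0].
by case: eqP => [_|]; [rewrite muln1 addn0 | lia].
Qed.

(* Super Catalan numbers as trigonometric moments: for [x = exp(2it)] the
   integrand is [(2 cos t)^(2k) (2 sin t)^(2l)]. *)
Lemma mean_super_catalan k l : (k + l < M)%N ->
  mean (fun x => (2 + (x + x^-1)) ^+ k * (2 - (x + x^-1)) ^+ l)
    = ((2 * k)`! * (2 * l)`!)%N%:R / (k`! * l`! * (k + l)`!)%N%:R.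
Proof.
have factN0 n : (n`!)%:R != 0 :> algC by rewrite pnatr_eq0 -lt0n fact_gt0.
elim: l k => [|l IHl] k ltM.
  rewrite addn0 in ltM *; rewrite muln0 fact0 !muln1.
  have le_k2k : (k <= 2 * k)%N by rewrite leq_pmull.
  have fE := bin_fact le_k2k.
  rewrite (_ : 2 * k - k = k)%N in fE; last by rewrite mul2n -addnn addnK.
  rewrite -fE natrM mulfK; last by rewrite natrM mulf_neq0.
  (* The base case rests on [2 + x + 1/x = (1 + x)(1 + 1/x)]. *)
  rewrite -(mean_central ltM).
  rewrite /mean; congr (_ * _); apply: eq_bigr => t _; rewrite mulr1 -exprMn.
  congr (_ ^+ _).
  have z0 : z ^+ t != 0 by rewrite expf_neq0 ?prim_root_neq0.
  by field.
(* Writing [2 - u] as [4 - (2 + u)] gives [S(k,l+1) = 4 S(k,l) - S(k+1,l)]. *)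
have e x : (2 + (x + x^-1)) ^+ k * (2 - (x + x^-1)) ^+ l.+1
    = 4 * ((2 + (x + x^-1)) ^+ k * (2 - (x + x^-1)) ^+ l)
      - (2 + (x + x^-1)) ^+ k.+1 * (2 - (x + x^-1)) ^+ l :> algC.
  by rewrite !exprS; ring.
rewrite (eq_mean e) meanB meanZ !IHl; [|lia..].
have dfactS n : (2 * n.+1)`! = ((2 * n + 2) * ((2 * n + 1) * (2 * n)`!))%N.
  by rewrite mulnS addnC addn2 addn1 !factS.
rewrite !dfactS (addSn k) (addnS k) (factS k) (factS l) (factS (k + l)) !natrM.
have := factN0 k; have := factN0 l; have := factN0 (k + l)%N; have := factN0 (2 * k)%N.
have := factN0 (2 * l)%N.
move: (k`!%:R) (l`!%:R) ((k + l)`!%:R) ((2 * k)`!%:R) ((2 * l)`!%:R) => a b c d f.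
move=> f0 d0 c0 b0 a0.
have h1 : k%:R + 1 != 0 :> algC by rewrite natr1 pnatr_eq0.
have h2 : l%:R + 1 != 0 :> algC by rewrite natr1 pnatr_eq0.
have h3 : k%:R + l%:R + 1 != 0 :> algC by rewrite -natrD natr1 pnatr_eq0.
rewrite -[k.+1%:R]natr1 -[l.+1%:R]natr1 -[(k + l).+1%:R]natr1 !mul2n -!addnn !natrD.
by field; rewrite a0 b0 c0 h1 h2 h3.
Qed.

(** Integer test vectors suffice, since positivity of the determinants is established over [int]. *)
Definition psd_hankel n (a : nat -> algC) :=
  forall x : 'I_n -> int, 0 <= \sum_i \sum_j (x i * x j)%:~R * a (i + j)%N.

Lemma psd_powers n w : w \is Num.real -> psd_hankel n (fun m => w ^+ m).
Proof.
move=> w_real x; pose s := \sum_i (x i)%:~R * w ^+ i.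
suff -> : \sum_i \sum_j (x i * x j)%:~R * w ^+ (i + j) = s ^+ 2.
  by rewrite -realEsqr rpred_sum // => i _; rewrite rpredM ?rpredX ?realz.
rewrite expr2 /s big_distrlr /=; apply: eq_bigr => i _; apply: eq_bigr => j _.
by rewrite intrM exprD; ring.
Qed.

Lemma psd_mean n (f : algC -> nat -> algC) :
  (forall x, x^-1 = x^* -> psd_hankel n (f x)) ->
  psd_hankel n (fun m => mean (f ^~ m)).
Proof.
move=> fP x; rewrite (_ : \sum_i _ =
    mean (fun y => \sum_i \sum_j (x i * x j)%:~R * f y (i + j)%N)).
  by apply: mean_ge0 => y yP; apply: fP.
rewrite mean_sum; apply: eq_bigr => i _; rewrite mean_sum.
by apply: eq_bigr => j _; rewrite meanZ.
Qed.

(** Averaging over [w] gives the squares [C(m,k)^2]; averaging over [y] and [x] then gives the two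
    central binomial factors. *)
Lemma Domb_mean m : (m < M)%N ->
  mean (fun x => mean (fun y => mean (fun w =>
     (((1 + x) + (1 + y) * w) * ((1 + x^-1) + (1 + y^-1) * w^-1)) ^+ m)))
  = (Domb m)%:R.
Proof.
move=> ltmM.
transitivity (mean (fun x => \sum_(k < m.+1) (('C(m, k) ^ 2 * 'C(2 * k, k))%N%:R
     * ((1 + x) ^+ (m - k) * (1 + x^-1) ^+ (m - k))))).
  apply: eq_mean => x.
  transitivity (mean (fun y => \sum_(k < m.+1) (('C(m, k) ^ 2)%N%:R
     * ((1 + x) ^+ (m - k) * (1 + x^-1) ^+ (m - k))) * ((1 + y) ^+ k * (1 + y^-1) ^+ k))).
    apply: eq_mean => y; under eq_mean => w do rewrite exprMn.
    by rewrite mean_normsq_expr //; apply: eq_bigr => k _; rewrite !exprMn.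
  rewrite mean_sum; apply: eq_bigr => k _.
  by rewrite meanZ mean_central ?(leq_trans (ltn_ord k)) // natrM; ring.
rewrite mean_sum /Domb natr_sum; apply: eq_bigr => k _.
by rewrite meanZ mean_central -?natrM //; have := ltn_ord k; lia.
Qed.

Lemma central_sqr_mean m : (m < M)%N ->
  mean (fun x => mean (fun y => ((x + x^-1) * (y + y^-1)) ^+ m)) = (central m ^ 2)%N%:R.
Proof.
move=> ltmM.
transitivity (mean (fun x => (central m)%:R * (x + x^-1) ^+ m)).
  apply: eq_mean => x; under eq_mean => y do rewrite exprMn.
  by rewrite meanZ mean_cos_expr // mulrC.
by rewrite meanZ mean_cos_expr // -natrM mulnn.
Qed.

Lemma CLF_mean m : (m < M)%N ->
  mean (fun x => mean (fun y => (8 + 2 * ((x + x^-1) * (y + y^-1))) ^+ m)) = ratr (CLF m).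
Proof.
move=> ltmM; pose S k : algC :=
  ((2 * (m - k))`! * (2 * k)`!)%N%:R / ((m - k)`! * k`! * m`!)%N%:R.
have meanS (k : 'I_m.+1) :
    mean (fun x => (2 + (x + x^-1)) ^+ (m - k) * (2 - (x + x^-1)) ^+ k) = S k.
  have lekm : (k <= m)%N by rewrite -ltnS.
  by rewrite mean_super_catalan subnK.
transitivity (mean (fun x => \sum_(k < m.+1) (('C(m, k))%:R * S k) *
    ((2 + (x + x^-1)) ^+ (m - k) * (2 - (x + x^-1)) ^+ k))).
  apply: eq_mean => x.
  transitivity (mean (fun y => \sum_(k < m.+1)
    (('C(m, k))%:R * ((2 + (x + x^-1)) ^+ (m - k) * (2 - (x + x^-1)) ^+ k)) *
    ((2 + (y + y^-1)) ^+ (m - k) * (2 - (y + y^-1)) ^+ k))).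
    apply: eq_mean => y.
    (* After this splitting each term of the binomial expansion is a function of [x] times a
       function of [y]. *)
    rewrite (_ : 8 + _ = (2 + (x + x^-1)) * (2 + (y + y^-1))
       + (2 - (x + x^-1)) * (2 - (y + y^-1))); last by ring.
    rewrite exprDn; apply: eq_bigr => k _.
    by rewrite -mulr_natr !exprMn; ring.
  by rewrite mean_sum; apply: eq_bigr => k _; rewrite meanZ meanS; ring.
rewrite mean_sum /CLF rmorph_sum; apply: eq_bigr => k _; rewrite meanZ meanS.
have lekm : (k <= m)%N by rewrite -ltnS.
rewrite fmorph_div !rmorph_nat.
have fE := bin_fact lekm.
have factE (n : nat) : ((2 * n)`!)%:R = ('C(2 * n, n))%:R * (n`!)%:R ^+ 2 :> algC.
  have le_n2n : (n <= 2 * n)%N by rewrite leq_pmull.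
  have := bin_fact le_n2n.
  rewrite (_ : 2 * n - n = n)%N; last by rewrite mul2n -addnn addnK.
  by move=> <-; rewrite !natrM.
have factN0 n : (n`!)%:R != 0 :> algC by rewrite pnatr_eq0 -lt0n fact_gt0.
have := factN0 k; have := factN0 (m - k)%N; have : ('C(m, k))%:R != 0 :> algC.
  by rewrite pnatr_eq0 -lt0n bin_gt0.
(* Here [S k] becomes [C(2k,k) C(2(m-k),m-k) / C(m,k)], so [C(m,k) (S k)^2] is the summand of
   [CLF m]. *)
rewrite /S !natrM !factE -fE !natrM.
move: (k`!%:R) ((m - k)`!%:R) ('C(m, k)%:R) ('C(2 * k, k)%:R) ('C(2 * (m - k), m - k)%:R).
move=> a b c d e c0 b0 a0.
by field; rewrite a0 b0 c0.
Qed.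

End CircleMean.

(** * Semidefiniteness, binomial transform and conclusion *)

(** The form only reads indices below [2n], so roots of unity of the single order [2n + 1] represent
    all the moments it needs. *)
Lemma eq_psd_hankel n (a b : nat -> algC) :
  (forall m, (m < 2 * n)%N -> a m = b m) -> psd_hankel n a -> psd_hankel n b.
Proof.
move=> e aP x; have := aP x; congr (0 <= _).
apply: eq_bigr => i _; apply: eq_bigr => j _; rewrite e //.
by have := ltn_ord i; have := ltn_ord j; lia.
Qed.

Lemma hankel_det_pos_odd4 (a : nat -> nat) n :
    (forall m, psd_hankel m (fun k => (a k)%:R)) ->
    a 0 = 1%N -> (forall m, 4 %| a m.+1)%N ->
    (forall m, odd (a m.+2 %/ 4) = odd (ballot m 0)) ->
  exists2 c : nat, odd c & hankel_det (fun m => (a m)%:Z) n = (4 ^ n * c)%N.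
Proof.
move=> aP a0 a4 a2; have odd4 m := hankel_det_odd4 m a0 a4 a2.
have pos : 0 < hankel_det (fun m => (a m)%:Z) n.
  apply: hankel_det_gt0 => [|m|m x]; first by rewrite a0.
    have [c oc ->] := odd4 m; rewrite mulf_neq0 ?expf_neq0 //.
    by apply: contraTneq oc => ->.
  rewrite -(ler0z algC) rmorph_sum /=; have := aP m x; congr (0 <= _).
  apply: eq_bigr => i _; rewrite rmorph_sum /=; apply: eq_bigr => j _.
  by rewrite [RHS]intrM -pmulrn.
have [c oc e] := odd4 n; exists `|c|%N => //; rewrite e in pos *.
have c0 : 0 <= c by apply: ltW; rewrite -(pmulr_rgt0 _ (_ : 0 < 4 ^+ n)) ?exprn_gt0.
by rewrite PoszM gez0_abs // -[Posz (4 ^ n)]natz natrX.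
Qed.

Lemma psd_Domb n : psd_hankel n (fun m => (Domb m)%:R).
Proof.
have [z zP] := C_prim_root_exists (ltn0Sn (2 * n)).
apply: (eq_psd_hankel (fun m ltm => Domb_mean zP (leqW ltm))).
apply: (psd_mean zP) => x xP; apply: (psd_mean zP) => y yP; apply: (psd_mean zP) => w wP.
apply: psd_powers; rewrite xP yP wP ger0_real //.
have -> : 1 + x^* + (1 + y^*) * w^* = (1 + x + (1 + y) * w)^*.
  by rewrite !rmorphD !rmorphM !rmorphD !rmorph1.
exact: mul_conjC_ge0.
Qed.

Lemma psd_central_sqr n : psd_hankel n (fun m => (central m ^ 2)%N%:R).
Proof.
have [z zP] := C_prim_root_exists (ltn0Sn (2 * n)).
apply: (eq_psd_hankel (fun m ltm => central_sqr_mean zP (leqW ltm))).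
apply: (psd_mean zP) => x xP; apply: (psd_mean zP) => y yP.
apply: psd_powers.
have real_cos (u : algC) : u^-1 = u^* -> u + u^-1 \is Num.real.
  by move=> ->; rewrite CrealE rmorphD /= conjCK addrC.
by rewrite rpredM ?real_cos.
Qed.

(** Expanding [(8 + 2v)^i] in powers of [v] gives a triangular [B] that turns the Hankel matrix [H]
    of the moments of [v] into [B *m H *m B^T]. *)
Lemma hankel_det_CLF n :
  hankel_det CLF n = 2 ^+ (n * n.+1) * hankel_det (fun m => (central m ^ 2)%N%:R) n.
Proof.
have [z zP] := C_prim_root_exists (ltn0Sn (2 * n)).
apply: (fmorph_inj (ratr : {rmorphism rat -> algC})).
rewrite rmorphM rmorphXn /= -!hankel_det_map rmorph_nat.
pose b i k : algC := 8 ^+ (i - k) * 2 ^+ k * ('C(i, k))%:R.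
pose B : 'M[algC]_n.+1 := \matrix_(i, k) b i k.
(* The diagonal entries [2^i] multiply to [2^(n(n+1)/2)]. *)
have detB : \det B ^+ 2 = 2 ^+ (n * n.+1).
  rewrite det_trig; last first.
    by apply/is_trig_mxP=> i j ltij; rewrite mxE /b bin_small ?mulr0.
  under eq_bigr => i _ do rewrite mxE /b subnn binn mul1r mulr1.
  rewrite prodrXr -exprM; congr (_ ^+ _).
  by rewrite -(big_mkord xpredT id) bin2_sum bin2 muln2 halfK oddM /= andNb subn0 mulnC.
pose H : 'M[algC]_n.+1 := \matrix_(i, j) (central (i + j) ^ 2)%N%:R.
transitivity (\det (B *m H *m B^T)).
  congr (\det _); apply/matrixP=> i j; rewrite mxE /=.
  have ltij : (i + j < (2 * n).+1)%N by have := ltn_ord i; have := ltn_ord j; lia.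
  rewrite -(CLF_mean zP ltij).
  have e (v : algC) : (8 + 2 * v) ^+ (i + j) =
      \sum_(k < n.+1) \sum_(l < n.+1) b i k * b j l * v ^+ (k + l).
    have e1 (i' : 'I_n.+1) : (8 + 2 * v) ^+ i' = \sum_(k < n.+1) b i' k * v ^+ k.
      rewrite exprDn (big_ord_widen n.+1 (fun k => 8 ^+ (i' - k) * (2 * v) ^+ k *+ 'C(i', k))) //.
      rewrite big_mkcond; apply: eq_bigr => k _; case: ltnP => [_|lt].
        by rewrite /b -mulr_natr exprMn; ring.
      by rewrite /b bin_small // mulr0 mul0r.
    rewrite exprD !e1 big_distrlr /=; apply: eq_bigr => k _; apply: eq_bigr => l _.
    by rewrite exprD; ring.
  transitivity (\sum_(k < n.+1) \sum_(l < n.+1) b i k * b j l * (central (k + l) ^ 2)%N%:R).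
    transitivity (mean n.*2.+1 z (fun x => \sum_(k < n.+1) \sum_(l < n.+1) b i k * b j l *
        mean n.*2.+1 z (fun y => ((x + x^-1) * (y + y^-1)) ^+ (k + l)))).
      rewrite -mul2n; apply: eq_mean => x; rewrite (eq_mean _ _ (fun y => e _)).
      rewrite mean_sum; apply: eq_bigr => k _; rewrite mean_sum; apply: eq_bigr => l _.
      by rewrite meanZ.
    rewrite -mul2n mean_sum; apply: eq_bigr => k _; rewrite mean_sum; apply: eq_bigr => l _.
    rewrite meanZ (central_sqr_mean zP) //.
    by have := ltn_ord k; have := ltn_ord l; lia.
  rewrite mxE exchange_big; apply: eq_bigr => l _; rewrite !mxE mulr_suml.
  by apply: eq_bigr => k _; rewrite !mxE; ring.
rewrite !det_mulmx det_tr mulrAC -expr2 detB; congr (_ * _).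
by congr (\det _); apply/matrixP=> i j; rewrite !mxE rmorph_nat.
Qed.

Lemma hankel_det_nat (R : comNzRingType) (a : nat -> nat) n c :
  hankel_det (fun m => (a m)%:Z) n = c%:Z -> hankel_det (fun m => (a m)%:R : R) n = c%:R.
Proof.
move=> e; rewrite [RHS]pmulrn -e -(hankel_det_map (intr : int -> R)).
by apply: eq_hankel_det => m; rewrite /= -pmulrn.
Qed.

(** All entries are 1 modulo 3, so subtracting row 0 makes each other row divisible by 3. *)
Lemma dvd3_hankel_det_Domb n :
  exists d : int, hankel_det (fun m => (Domb m)%:Z) n = 3 ^+ n * d.
Proof.
have DombE m : (Domb m)%:Z = 1 + 3 * (Domb m %/ 3)%N%:Z.
  have r1 : (Domb m %% 3 = 1)%N by have := congr1 val (Domb_mod3 m); rewrite /= val_Fp_nat.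
  by have := divn_eq (Domb m) 3; rewrite r1; lia.
eexists; apply: (@hankel_det_factor _ _ 1 3
  (fun i j => (Domb (i + j) %/ 3)%N%:Z - (Domb j %/ 3)%N%:Z)) => i j.
by rewrite (DombE (_ + _)%N) (DombE j); ring.
Qed.

Theorem theorem1p2 (n : nat) :
  (exists2 k : nat, (0 < k)%N && odd k &
     hankel_det (fun m => ((Domb m)%:R : rat)) n = ((12 ^ n * k)%N)%:R)
  /\
  (exists2 k : nat, (0 < k)%N && odd k &
     hankel_det CLF n = ((2 ^ (n * (n + 3)) * k)%N)%:R).
Proof.
split.
  have [|m|m|c oc e] := @hankel_det_pos_odd4 Domb n psd_Domb.
  - by rewrite /Domb big_ord1.
  - by rewrite Domb4E dvdn_mulr.
  - by rewrite Domb4E mulKn // odd_Domb4 odd_bin_ballot.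
  have [d e3] := dvd3_hankel_det_Domb n.
  have : (3 ^ n %| 4 ^ n * c)%N.
    have : `|(3 ^+ n * d)%R|%N = (4 ^ n * c)%N by rewrite -e3 e.
    by rewrite abszM abszX => <-; rewrite dvdn_mulr.
  (* Since [3^n] is coprime to [4^n] it divides the odd [c], and the quotient stays odd. *)
  rewrite Gauss_dvdr ?coprimeXl ?coprimeXr // => /dvdnP[k ck].
  exists k; first by move: oc; rewrite ck oddM => /andP[ok _]; rewrite ok odd_gt0.
  rewrite (hankel_det_nat _ e) ck; congr _%:R.
  by rewrite (_ : 12 = 4 * 3)%N // expnMn; lia.
have [|m|m|c oc e] := @hankel_det_pos_odd4 (fun m => central m ^ 2)%N n psd_central_sqr.
- by rewrite /central.
- rewrite /central; case: (boolP (odd m.+1)) => om //.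
  have -> : m.+1 = (2 * (m./2).+1)%N by move: om => /=; lia.
  by rewrite mul2n doubleK -mul2n bin_central_half expnMn dvdn_mulr.
- rewrite odd_ballot0 /central /= negbK; case: (boolP (odd m)) => om //=.
  have -> : m.+2 = (2 * (m./2).+1)%N by lia.
  rewrite bin_central_half expnMn mulKn // oddX /=.
  by congr (odd 'C(_, _)); lia.
exists c; first by rewrite oc odd_gt0.
rewrite hankel_det_CLF (hankel_det_nat _ e) -natrX -natrM; congr _%:R.
(* The exponents add up to [n(n+1) + 2n = n(n+3)]. *)
by rewrite mulnA (_ : 4 = 2 ^ 2)%N // -expnM -expnD; congr (2 ^ _ * _)%N; lia.
Qed.
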